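(* Let $G$ be a finite group, let $S$ be a generating set of $G$, and let $\chi$ be an irreducible complex character of $G$ of degree $d=\chi(1)$. Then the character-to-matrices algorithm described in the context returns matrices defining an irreducible representation of $G$ with character $\chi$. Explicitly: the steps of the algorithm can be carried out, and for every choice of a maximizer $v$ of $F$ on the unit sphere of $V_\chi$, every choice of $h_1,\dots,h_d\in G$ such that $\lambda(h_1)v,\dots,\lambda(h_d)v$ are linearly independent, and the matrix $B$ with these vectors as columns, the equations $\lambda(s)B=BA_s$ $(s\in S)$ have solutions $A_s\in M_d(\mathbb C)$, and for these matrices there is an irreducible representation $A:G\to GL_d(\mathbb C)$ with character $\chi$ such that $A(s)=A_s$ for all $s\in S$.
   Context: Let $\lambda:G\to GL(\mathbb C[G])$ be the left regular representation, $\lambda(g)e_h=e_{gh}$, where $(e_h)_{h\in G}$ is the standard basis of $\mathbb C[G]$. Equip $\mathbb C[G]$ with the standard Hermitian inner product for which $(e_h)_{h\in G}$ is orthonormal (conjugate-linear in the first variable, linear in the second); $\lambda$ is then unitary. The algorithm (in exact arithmetic, with the maximization step taken to return a global maximizer) takes $G$ and $\chi$ as input and proceeds as follows. (1) Construct $\lambda$. (2) Form the isotypic projector $P_\chi=\frac{d}{|G|}\sum_{g\in G}\overline{\chi(g)}\,\lambda(g)$. (3) Compute a basis of $V_\chi=\operatorname{im}(P_\chi)$. (4) Choose $u\in\mathbb C[G]$ with $P_\chi u\ne0$ and set $v_0=P_\chi u/\|P_\chi u\|$. (5) Starting from $v_0$, maximize $F(v)=\frac1{|G|}\sum_{g\in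 G}|\langle v,\lambda(g)v\rangle|^2$ on the unit sphere of $V_\chi$. (6) Let $v$ be a maximizer, so that $F(v)=1/d$. (7) Choose $h_1,\dots,h_d\in G$ such that $\lambda(h_1)v,\dots,\lambda(h_d)v$ are linearly independent. (8) Let $B$ be the $|G|\times d$ matrix whose columns are these vectors (in coordinates with respect to the basis $(e_h)$, $\lambda(s)$ being regarded as a $|G|\times|G|$ matrix). (9) For each generator $s\in S$ solve $\lambda(s)B=BA_s$ for $A_s\in M_d(\mathbb C)$. Return the matrices $A_s$, $s\in S$. *)

(* Defs.v *)
From HB Require Import structures.
From mathcomp Require Import all_boot all_order all_algebra all_fingroup.
From mathcomp Require Import all_character.
From mathcomp Require Import complex reals.

Set Implicit Arguments.
Unset Strict Implicit.
Unset Printing Implicit Defensive.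

Import Order.TTheory GRing.Theory Num.Theory.
Local Open Scope ring_scope.

Section CharacterToMatrices.

Variables (C : numClosedFieldType) (gT : finGroupType) (G : {group gT}).

(* mx_irreducible is phrased with invariant row spaces; passing to annihilators
   shows that this agrees with irreducibility on column vectors. *)
Definition affords n (rG : mx_representation C G n) (chi : gT -> C) : Prop :=
  {in G, forall g, \tr (rG g) = chi g}.

(* classfun.v and character.v only treat characters with values in algC, so
   irreducible characters with values in C are defined here. Only the values
   of chi on G are constrained. *)
Definition irreducible_character (chi : gT -> C) : Prop :=
  exists n (rG : mx_representation C G n),
    mx_irreducible rG /\ affords rG chi.

(* C[G] is the space of column vectors indexed by G through enum_val and
   gring_index. The regular_repr of mxrepresentation.v instead encodes right
   translation acting on row vectors. *)
Definition cgroup_basis (h : gT) : 'cV[C]_#|G| := delta_mx (gring_index G h) 0.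

Definition left_regular_mx (g : gT) : 'M[C]_#|G| :=
  \matrix_(i, j) (enum_val i == g * enum_val j)%g%:R.

Lemma left_regular_mx_basis : {in G &, forall g h,
  left_regular_mx g *m cgroup_basis h = cgroup_basis (g * h)%g}.
Proof.
move=> g h Gg Gh; rewrite /cgroup_basis -colE; apply/colP=> i.
rewrite !mxE eqxx andbT gring_indexK // -[i in RHS](gring_valK i).
by rewrite (can_in_eq (@gring_indexK _ G)) ?groupM ?enum_valP.
Qed.

Lemma left_regular_mx_repr : mx_repr G left_regular_mx.
Proof.
have basisE i : delta_mx i 0 = cgroup_basis (enum_val i).
  by rewrite /cgroup_basis gring_valK.
split=> [|x y Gx Gy].
  apply/matrixP=> i j; rewrite !mxE mul1g.
  by rewrite (can_eq (@gring_valK _ G)).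
apply/trmx_inj/row_matrixP=> j; rewrite -!tr_col; congr (_^T).
rewrite !colE basisE -mulmxA.
by rewrite !left_regular_mx_basis ?groupM ?enum_valP ?mulgA.
Qed.

Definition left_regular_repr : mx_representation C G #|G| :=
  MxRepresentation left_regular_mx_repr.

Definition inner n (v w : 'cV[C]_n) : C := \sum_i (v i 0)^* * w i 0.

Definition vnorm n (v : 'cV[C]_n) : C := sqrtC (inner v v).

Definition isotypic_projector (chi : gT -> C) : 'M[C]_#|G| :=
  (chi 1%g / #|G|%:R) *: \sum_(g in G) (chi g)^* *: left_regular_repr g.

Definition isotypic_space (chi : gT -> C) : {vspace 'cV[C]_#|G|} :=
  limg (linfun (mulmx (isotypic_projector chi) : 'cV_#|G| -> 'cV_#|G|)).

Definition unit_sphere (V : {vspace 'cV[C]_#|G|}) (v : 'cV[C]_#|G|) : Prop :=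
  v \in V /\ vnorm v = 1.

(* F takes nonnegative real values, on which the partial order of C is the
   usual order of the reals. *)
Definition orbit_energy (v : 'cV[C]_#|G|) : C :=
  #|G|%:R^-1 * \sum_(g in G) `|inner v (left_regular_repr g *m v)| ^+ 2.

Definition energy_maximizer (chi : gT -> C) (v : 'cV[C]_#|G|) : Prop :=
  unit_sphere (isotypic_space chi) v /\
  forall w, unit_sphere (isotypic_space chi) w ->
    orbit_energy w <= orbit_energy v.

Definition translates d (h : 'I_d -> gT) (v : 'cV[C]_#|G|) :
    d.-tuple 'cV[C]_#|G| :=
  [tuple left_regular_repr (h i) *m v | i < d].

Definition translates_mx d (h : 'I_d -> gT) (v : 'cV[C]_#|G|) :
    'M[C]_(#|G|, d) :=
  \matrix_(i, j) (tnth (translates h v) j) i 0.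

End CharacterToMatrices.

(* Main.v *)
Require Import Defs.
From HB Require Import structures.
From mathcomp Require Import all_boot all_order all_algebra all_fingroup.
From mathcomp Require Import all_character.
From mathcomp Require Import complex reals.
From mathcomp Require Import ring.

Set Implicit Arguments.
Unset Strict Implicit.
Unset Printing Implicit Defensive.

Import Order.TTheory GRing.Theory Num.Theory.
Local Open Scope ring_scope.
Local Open Scope sesquilinear_scope.

(** Fix a unitary irreducible matrix representation r affording chi. The vectors
   [coef_vec r X], with entries tr(X r(h)^-1) for h in G, fill the chi-isotypic
   space when X ranges over all d x d matrices, and left translation by g
   becomes the left multiplication X |-> r(g) X. The first claim comes from an
   identity of Schur, [fourier_inversion]:
     sum_g tr(A r(g)) r(g)^-1 = (|G| / d) A,
   which also turns the geometry of C[G] into that of matrices. The inner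
   product of the vectors of X and Y is (|G| / d) tr(X^t* Y), and the energy of
   the vector of X is (|G|^2 / d^3) tr(H^2), where H is the product of X and its
   conjugate transpose X^t* .

   On the unit sphere tr H is constant, so the energy is d^-1 times the ratio
   tr(H^2) / (tr H)^2. Lagrange's identity ([lagrange_minors]) writes the
   difference (tr H)^2 - tr(H^2) as half the sum of the squared moduli of the
   2 x 2 minors of X, over ordered pairs of rows and of columns. Hence the
   energy is at most 1 / d, and the maximizers are exactly the unit vectors given
   by matrices X of rank one ([energy_eq]). In particular a maximizer can be
   written down explicitly.

   For X = a b of rank one, every translate of the vector is the image under a
   fixed injective intertwiner, [copy_mx r b], of a vector r(g) a in C^d. The
   matrix B of the algorithm thus factors as (copy_mx r b) T, where the columns
   of T are the vectors r(h_i) a. The translates are independent exactly when T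
   is invertible, and lambda(s) B = B A_s then says that A_s = T^-1 r(s) T.
   Suitable h_i exist because the orbit of a nonzero vector spans C^d.

   A unitary r is found inside the regular representation: a matrix coefficient
   map embeds any irreducible representation there ([orbit_mx]), and
   Gram-Schmidt supplies an orthonormal basis of its image. *)

(** * Hermitian vectors and matrices *)

Section Hermitian.

Variable C : numClosedFieldType.

Lemma inner_ge0 n (v : 'cV[C]_n) : 0 <= inner v v.
Proof. by apply: sumr_ge0 => i _; rewrite mulrC mul_conjC_ge0. Qed.

Lemma inner_eq0 n (v : 'cV[C]_n) : (inner v v == 0) = (v == 0).
Proof.
apply/eqP/eqP=> [v0 | ->]; last first.
  by rewrite /inner big1 // => i _; rewrite mxE mulr0.
have ge0 i : 0 <= (v i 0)^* * v i 0 by rewrite mulrC mul_conjC_ge0.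
apply/colP=> i; have /psumr_eq0P/(_ i isT)/eqP := v0 => /(_ (fun i _ => ge0 i)).
by rewrite mulrC mul_conjC_eq0 mxE => /eqP.
Qed.

Lemma vnorm_normalize n (v : 'cV[C]_n) : v != 0 ->
  vnorm ((vnorm v)^-1 *: v) = 1.
Proof.
move=> nz_v; have nz_n : vnorm v != 0 by rewrite sqrtC_eq0 inner_eq0.
have n_ge0 : 0 <= vnorm v by rewrite sqrtC_ge0 inner_ge0.
rewrite {1}/vnorm; suff -> : inner ((vnorm v)^-1 *: v) ((vnorm v)^-1 *: v) = 1.
  by rewrite sqrtC1.
transitivity (((vnorm v)^-1 ^+ 2) * inner v v).
  rewrite mulr_sumr; apply: eq_bigr => i _; rewrite !mxE rmorphM fmorphV /=.
  by rewrite (CrealP (ger0_real n_ge0)); ring.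
by rewrite -(sqrtCK (inner v v)) -exprMn mulVf // expr1n.
Qed.

Lemma vnorm1_inner n (v : 'cV[C]_n) : vnorm v = 1 -> inner v v = 1.
Proof. by move=> v1; rewrite -[LHS]sqrtCK -/(vnorm v) v1 expr1n. Qed.

Lemma mxtraceC_conj n (A : 'M[C]_n) : (\tr A)^* = \tr (A^t*).
Proof. by rewrite rmorph_sum; apply: eq_bigr => i _; rewrite !mxE. Qed.

Lemma trmxC_mul m n p (A : 'M[C]_(m, n)) (B : 'M[C]_(n, p)) :
  (A *m B)^t* = B^t* *m A^t*.
Proof. by rewrite trmx_mul map_mxM. Qed.

(** Lagrange's identity summed over all pairs of rows i, j: both sides expand
   into the same quartic sums, up to exchanging the column indices k, l. *)
Lemma lagrange_minors m n (X : 'M[C]_(m, n)) (H := X *m X^t*) :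
  \sum_i \sum_j \sum_k \sum_l `|X i k * X j l - X i l * X j k| ^+ 2
    = 2 * ((\tr H) ^+ 2 - \tr (H *m H)).
Proof.
pose T1 := \sum_i \sum_j \sum_k \sum_l
  (X i k * (X i k)^*) * (X j l * (X j l)^*).
pose T2 := \sum_i \sum_j \sum_k \sum_l
  (X i k * (X j k)^*) * (X j l * (X i l)^*).
have T1E : T1 = (\tr H) ^+ 2.
  rewrite expr2 /mxtrace mulr_suml; apply: eq_bigr => i _.
  rewrite mulr_sumr; apply: eq_bigr => j _.
  rewrite !mxE mulr_suml; apply: eq_bigr => k _.
  by rewrite mulr_sumr; apply: eq_bigr => l _; rewrite !mxE.
have T2E : T2 = \tr (H *m H).
  rewrite /mxtrace; apply: eq_bigr => i _.
  rewrite mxE; apply: eq_bigr => j _.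
  rewrite !mxE mulr_suml; apply: eq_bigr => k _.
  by rewrite mulr_sumr; apply: eq_bigr => l _; rewrite !mxE.
have swap (F : 'I_m -> 'I_m -> 'I_n -> 'I_n -> C) :
    \sum_i \sum_j \sum_k \sum_l F i j k l
      = \sum_i \sum_j \sum_k \sum_l F i j l k.
  by apply: eq_bigr => i _; apply: eq_bigr => j _; exact: exchange_big.
(* Each squared modulus has two terms from T1 and two from T2; in the second
   copy of each sum k and l are exchanged to match them. *)
transitivity ((T1 - T2) + (T1 - T2)).
  rewrite [X in _ = _ + (X - _)](swap _) [X in _ = _ + (_ - X)](swap _) /T1 /T2.
  do 4!(rewrite -!sumrB -!big_split; apply: eq_bigr => ? _).
  by rewrite normCK rmorphB !rmorphM /=; ring.
by rewrite T1E T2E -mulr2n mulr_natl.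
Qed.

Lemma gram_trace_sq_le m n (X : 'M[C]_(m, n)) (H := X *m X^t*) :
  \tr (H *m H) <= (\tr H) ^+ 2.
Proof.
rewrite -subr_ge0 -(@pmulr_rge0 _ 2) ?ltr0n // -lagrange_minors.
by do 4!apply: sumr_ge0 => ? _; rewrite exprn_ge0.
Qed.

(** Equality forces all 2 x 2 minors of X to vanish, so that the row and the
   column through a nonzero entry determine X. *)
Lemma gram_trace_sq_eq m n (X : 'M[C]_(m, n)) (H := X *m X^t*) :
  \tr (H *m H) = (\tr H) ^+ 2 <->
  exists (a : 'cV_m) (b : 'rV_n), X = a *m b.
Proof.
split=> [eqH | [a [b defX]]]; last first.
  apply/esym/eqP; rewrite -subr_eq0 -(mulrI_eq0 _ (@mulfI _ 2 _)) ?pnatr_eq0 //.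
  rewrite -lagrange_minors defX; apply/eqP.
  do 4!apply: big1 => ? _; rewrite !mxE !big_ord1; set z := (X in `|X|).
  by suff ->: z = 0; [rewrite normr0 expr0n | rewrite /z; ring].
have [-> | nzX] := eqVneq X 0; first by exists 0, 0; rewrite mul0mx.
have /matrix0Pn[i0 [k0 nzXik]] := nzX.
exists (col k0 X), ((X i0 k0)^-1 *: row i0 X).
apply/matrixP=> j l; rewrite !mxE big_ord1 !mxE mulrCA; apply: (mulfI nzXik).
rewrite mulVKf //; apply/eqP; rewrite -subr_eq0 -normr_eq0 [X j k0 * _]mulrC.
rewrite -sqrf_eq0.
have L : _ = 2 * (_ - \tr (H *m H)) := lagrange_minors X.
move: L; rewrite eqH subrr mulr0 !pair_bigA => /psumr_eq0P.
by move=> /(_ (fun _ _ => exprn_ge0 _ (normr_ge0 _)) (i0, j, k0, l) isT)->.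
Qed.

End Hermitian.

Lemma row_free_trP (F : fieldType) m n (A : 'M[F]_(m, n)) :
  reflect (forall y : 'cV_n, A *m y = 0 -> y = 0) (row_free A^T).
Proof.
apply: (iffP idP) => [freeA y Ay0 | inj].
  apply: trmx_inj; apply: (row_free_inj freeA).
  by rewrite -trmx_mul Ay0 !trmx0 mul0mx.
rewrite -kermx_eq0; apply/eqP/row_matrixP=> i.
apply: trmx_inj; rewrite row0 trmx0; apply: inj; apply: trmx_inj.
by rewrite trmx_mul trmxK -row_mul mulmx_ker row0 trmx0.
Qed.

(** * Schur orthogonality *)

Section Schur.

Variables (C : numClosedFieldType) (gT : finGroupType) (G : {group gT}).
Variables (d : nat) (r : mx_representation C G d).
Hypothesis irr_r : mx_irreducible r.

Let order_neq0 : #|G|%:R != 0 :> C.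
Proof. by rewrite pnatr_eq0 -lt0n cardG_gt0. Qed.

Lemma irr_degree_gt0 : (0 < d)%N.
Proof. by case/mx_irrP: irr_r. Qed.

Lemma irr_degree_neq0 : d%:R != 0 :> C.
Proof. by rewrite pnatr_eq0 -lt0n irr_degree_gt0. Qed.

(** The average of X commutes with the representation, so Schur's lemma makes it
   scalar; the scalar is read off from the trace. *)
Lemma group_average_scalar (X : 'M[C]_d) :
  \sum_(g in G) r g^-1%g *m X *m r g = (#|G|%:R / d%:R * \tr X)%:M.
Proof.
set Y := \sum_(g in G) _.
have cGY : centgmx r Y.
  apply/centgmxP=> h Gh; rewrite /Y mulmx_suml mulmx_sumr.
  rewrite (reindex_inj (mulIg h^-1%g)).
  apply: eq_big => [g | g]; rewrite groupMr ?groupV // => Gg.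
  rewrite invMg invgK !repr_mxM ?groupV //.
  by rewrite -!mulmxA -repr_mxM ?groupV // mulVg repr_mx1 mulmx1.
have absr := @group_closure_closed_field C gT G d r irr_r.
have /is_scalar_mxP[y defY] := mx_abs_irr_cent_scalar absr cGY.
rewrite defY; congr _%:M; apply: (mulIf irr_degree_neq0).
rewrite mulrAC divfK ?irr_degree_neq0 // mulr_natr -mxtrace_scalar -defY.
rewrite raddf_sum mulr_natl -sumr_const; apply: eq_bigr => g Gg /=.
by rewrite mxtrace_mulC mulmxA -repr_mxM ?groupV // mulgV repr_mx1 mul1mx.
Qed.

(** The averages of the elementary matrices give all products of matrix
   coefficients, of which this is the basis-free form. *)
Lemma fourier_inversion (A : 'M[C]_d) :
  \sum_(g in G) \tr (A *m r g) *: r g^-1%g = (#|G|%:R / d%:R) *: A.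
Proof.
have trace_delta (j k : 'I_d) : \tr (delta_mx j k : 'M[C]_d) = (j == k)%:R.
  rewrite /mxtrace (bigD1 j) //= mxE eqxx big1 ?addr0 // => i /negPf ni.
  by rewrite mxE ni.
(* This is entry (i, l) of the average of the elementary matrix E_jk. *)
have matrix_coef i j k l :
    \sum_(g in G) r g^-1%g i j * r g k l
      = #|G|%:R / d%:R * (j == k)%:R * (i == l)%:R.
  have /matrixP/(_ i l) := group_average_scalar (delta_mx j k).
  rewrite summxE [in RHS]mxE trace_delta -[_ *+ (i == l)]mulr_natr => <-.
  apply: eq_bigr => g _; rewrite mxE (bigD1 k) //= mxE (bigD1 j) //= mxE !eqxx.
  rewrite mulr1 !big1 ?addr0 // => [k' /negPf nk | j' /negPf nj].
    by rewrite mxE big1 ?mul0r // => j' _; rewrite mxE nk andbF mulr0.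
  by rewrite mxE nj mulr0.
apply/matrixP=> m l; rewrite summxE.
transitivity (\sum_j \sum_k A j k * \sum_(g in G) r g^-1%g m l * r g k j).
  under eq_bigr => g Gg.
    rewrite mxE /mxtrace mulr_suml; under eq_bigr => j _.
      rewrite mxE mulr_suml; over.
    over.
  rewrite exchange_big; apply: eq_bigr => j _.
  rewrite exchange_big; apply: eq_bigr => k _.
  by rewrite mulr_sumr; apply: eq_bigr => g _ /=; ring.
rewrite (bigD1 m) //= (bigD1 l) //= matrix_coef !eqxx !mulr1 mxE mulrC.
rewrite !big1 ?addr0 // => [j /negPf nj | k /negPf nk].
  by rewrite big1 // => k _; rewrite matrix_coef (eq_sym m) nj !mulr0.
by rewrite matrix_coef (eq_sym l) nk mulr0 mul0r mulr0.
Qed.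

Lemma schur_trace_mul (A B : 'M[C]_d) :
  \sum_(g in G) \tr (A *m r g) * \tr (B *m r g^-1%g)
    = #|G|%:R / d%:R * \tr (B *m A).
Proof.
rewrite -mxtraceZ scalemxAr -fourier_inversion mulmx_sumr raddf_sum /=.
by apply: eq_bigr => g _; rewrite -scalemxAr mxtraceZ.
Qed.

End Schur.

(** * Embedding in the regular representation and unitarity *)

Section Orbit.

Variables (C : numClosedFieldType) (gT : finGroupType) (G : {group gT}).

Lemma left_regular_mulE p (M : 'M[C]_(#|G|, p)) g i k : g \in G ->
  (left_regular_repr C G g *m M) i k
    = M (gring_index G (g^-1 * enum_val i)%g) k.
Proof.
move=> Gg; have Gi : (g^-1 * enum_val i)%g \in G.
  by rewrite groupM ?groupV ?enum_valP.
rewrite mxE (bigD1 (gring_index G (g^-1 * enum_val i)%g)) //= mxE.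
rewrite gring_indexK // mulKVg eqxx mul1r big1 ?addr0 // => j nj.
rewrite mxE; case: eqP => [eq_i | _]; last by rewrite mul0r.
by rewrite eq_i mulKg gring_valK eqxx in nj.
Qed.

Lemma left_regular_adjoint g : g \in G ->
  (left_regular_repr C G g)^t* = left_regular_repr C G g^-1%g.
Proof.
move=> Gg; apply/matrixP=> i j; rewrite !mxE conjC_nat.
by rewrite eq_sym (can2_eq (mulKg g) (mulKVg g)).
Qed.

(** The map x |-> (x r(g) c)_g embeds row vectors in the regular
   representation. The columns r(g) c of this matrix are also the orbit of c,
   so that its freeness has two readings: injectivity of the embedding, and
   spanning of the column space by the orbit. *)
Definition orbit_mx d (r : mx_representation C G d) (c : 'cV_d) :
    'M[C]_(d, #|G|) :=
  \matrix_(i, j) (r (enum_val j) *m c) i 0.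

Variables (d : nat) (r : mx_representation C G d).

Lemma orbit_mx_hom c g : g \in G ->
  r g *m orbit_mx r c = orbit_mx r c *m left_regular_repr C G g.
Proof.
move=> Gg; apply/matrixP=> i j; have Gj := enum_valP j.
transitivity ((r g *m (r (enum_val j) *m c)) i 0).
  by rewrite [LHS]mxE [RHS]mxE; apply: eq_bigr => k _; rewrite mxE.
rewrite mulmxA -repr_mxM // [RHS]mxE.
rewrite (bigD1 (gring_index G (g * enum_val j)%g)) //= !mxE.
rewrite gring_indexK ?groupM // eqxx mulr1 [X in _ + X]big1 ?addr0 // => k nk.
rewrite [X in _ * X]mxE; have [def_k | _] := eqVneq; last by rewrite mulr0.
by rewrite -def_k gring_valK eqxx in nk.
Qed.

(** The kernel of the embedding is a submodule. It is proper, since x c = 0 for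
   all its elements x while c is nonzero, so it vanishes by irreducibility. *)
Lemma orbit_mx_free c : mx_irreducible r -> c != 0 -> row_free (orbit_mx r c).
Proof.
case/mx_irrP=> _ irr_r; apply: contraNT; rewrite -kermx_eq0 => nzK.
have modK : mxmodule r (kermx (orbit_mx r c)).
  apply/mxmoduleP=> g Gg; apply/sub_kermxP.
  by rewrite -mulmxA orbit_mx_hom // mulmxA mulmx_ker mul0mx.
have:= irr_r _ modK nzK; rewrite -sub1mx => /sub_kermxP; rewrite mul1mx => E0.
apply/eqP/colP=> i; move/matrixP/(_ i (gring_index G 1)): E0.
by rewrite mxE gring_indexK ?group1 // repr_mx1 mul1mx !mxE.
Qed.

(** If the rows of S form an orthonormal basis of a copy inside the regular
   representation lambda, then g acts in this basis by S lambda(g) S^t*, whose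
   conjugate transpose is the same expression for g^-1 because lambda(g) is a
   permutation matrix. *)
Lemma irr_unitarizable : mx_irreducible r ->
  exists r' : mx_representation C G d,
    [/\ mx_irreducible r', {in G, forall g, (r' g)^t* = r' g^-1%g}
      & {in G, forall g, \tr (r' g) = \tr (r g)}].
Proof.
move=> irr_r; have [d_gt0 _] := (mx_irrP _).1 irr_r.
pose E := orbit_mx r (delta_mx (Ordinal d_gt0) 0).
have freeE : row_free E.
  apply: orbit_mx_free => //; apply/eqP=> /matrixP/(_ (Ordinal d_gt0) 0).
  by rewrite !mxE !eqxx => /eqP; rewrite oner_eq0.
pose S := schmidt E.
have uS : S \is unitarymx.
  by rewrite schmidt_unitarymx // -(eqP freeE) rank_leq_col.
have /submxP[B defS] : (S <= E)%MS by rewrite eqmx_schmidt_free.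
have uB : B \in unitmx.
  rewrite -row_free_unit /row_free eqn_leq rank_leq_row.
  by rewrite -{1}(mxrank_unitary uS) defS mxrankM_maxl.
exists (rconj_repr r uB); split; first exact/conj_mx_irr; last first.
  by move=> g Gg; rewrite rconj_mxE mxtrace_mulC mulKmx.
have conjE g : g \in G ->
    rconj_repr r uB g = S *m left_regular_repr C G g *m S^t*.
  move=> Gg; rewrite -[LHS]mulmx1 -(unitarymxP uS) mulmxA; congr (_ *m _).
  rewrite {1}defS mulmxA rconj_mxE mulmxKV // -mulmxA orbit_mx_hom //.
  by rewrite mulmxA defS.
move=> g Gg; rewrite !conjE ?groupV // !trmxC_mul trmxCK.
by rewrite left_regular_adjoint // mulmxA.
Qed.

End Orbit.

(** * The isotypic space as a space of matrices *)

Section CoefficientVectors.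

Variables (C : numClosedFieldType) (gT : finGroupType) (G : {group gT}).
Variables (d : nat) (r : mx_representation C G d) (chi : gT -> C).
Hypothesis irr_r : mx_irreducible r.
Hypothesis unitary_r : {in G, forall g, (r g)^t* = r g^-1%g}.
Hypothesis chi_r : affords r chi.

Let order_neq0 : #|G|%:R != 0 :> C.
Proof. by rewrite pnatr_eq0 -lt0n cardG_gt0. Qed.
Let degree_neq0 : d%:R != 0 :> C := irr_degree_neq0 irr_r.

Let chi1 : chi 1%g = d%:R.
Proof. by rewrite -chi_r // repr_mx1 mxtrace1. Qed.

(** The inverse makes left translation of functions act on X by left
   multiplication. *)
Definition coef_vec (X : 'M[C]_d) : 'cV[C]_#|G| :=
  \col_i \tr (X *m r (enum_val i)^-1%g).

Lemma coef_vec_is_linear : linear coef_vec.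
Proof.
move=> a X Y; apply/colP=> i; rewrite !mxE -mxtraceZ -raddfD /=.
by rewrite mulmxDl scalemxAl.
Qed.
HB.instance Definition _ :=
  GRing.isLinear.Build C 'M[C]_d 'cV[C]_#|G| _ coef_vec coef_vec_is_linear.

(** Fourier inversion recovers X from the entries of its vector. *)
Lemma coef_vec_inj : injective coef_vec.
Proof.
apply: raddf_inj => X X0; apply/eqP.
have c_neq0 : #|G|%:R / d%:R != 0 :> C by rewrite mulf_neq0 ?invr_eq0.
rewrite -[_ == 0]orFb -(negPf c_neq0) -scaler_eq0 -(fourier_inversion irr_r).
rewrite big1 // => g Gg; move/colP/(_ (gring_index G g^-1)): X0.
by rewrite !mxE gring_indexK ?groupV // invgK => ->; rewrite scale0r.
Qed.

Lemma left_regular_coef_vec g X : g \in G ->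
  left_regular_repr C G g *m coef_vec X = coef_vec (r g *m X).
Proof.
move=> Gg; apply/colP=> i; have Gi := enum_valP i.
rewrite left_regular_mulE // !mxE gring_indexK ?groupM ?groupV //.
by rewrite invMg invgK repr_mxM ?groupV // mulmxA mxtrace_mulC mulmxA.
Qed.

Let chi_conj g : g \in G -> (chi g)^* = \tr (r g^-1%g).
Proof. by move=> Gg; rewrite -chi_r // mxtraceC_conj unitary_r. Qed.

(** The projector acts on X as left multiplication by the multiple
   (d / |G|) sum_g tr(r(g)^-1) r(g) of the Fourier inversion of the identity. *)
Lemma projector_coef_vec X :
  isotypic_projector G chi *m coef_vec X = coef_vec X.
Proof.
rewrite -scalemxAl mulmx_suml.
transitivity ((chi 1%g / #|G|%:R) *:
    coef_vec ((\sum_(g in G) \tr (1%:M *m r g) *: r g^-1%g) *m X)).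
  congr (_ *: _); rewrite (reindex_inj invg_inj) /= mulmx_suml linear_sum /=.
  apply: eq_big => [g | g]; rewrite groupV // => Gg.
  rewrite -!scalemxAl linearZ /= left_regular_coef_vec ?groupV //.
  by rewrite chi_conj ?groupV // invgK mul1mx.
rewrite fourier_inversion // -scalemxAl mul1mx linearZ /= scalerA chi1.
by rewrite mulrA divfK // divff // scale1r.
Qed.

(** Substituting g = k h^-1 in the value sum_g tr(r(g)^-1) u(g^-1 k) of the
   projection at k gives sum_h u(h) tr(r(h) r(k)^-1). *)
Lemma projector_image u : exists X,
  isotypic_projector G chi *m u = coef_vec X.
Proof.
exists ((chi 1%g / #|G|%:R) *:
  \sum_(h in G) u (gring_index G h) 0 *: r h).
apply/colP=> i; have Gi := enum_valP i.
rewrite linearZ -scalemxAl [LHS]mxE [RHS]mxE; congr (_ * _).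
rewrite mulmx_suml summxE [RHS]mxE mulmx_suml raddf_sum /=.
rewrite (reindex_inj (mulgI (enum_val i))) /=.
rewrite (reindex_inj invg_inj) /=.
apply: eq_big => [h | h]; rewrite groupMl // groupV // => Gh.
rewrite -scalemxAl mxE left_regular_mulE ?groupM ?groupV //.
rewrite chi_conj ?groupM ?groupV // !invMg !invgK mulgKV.
by rewrite -scalemxAl mxtraceZ mulrC repr_mxM ?groupV.
Qed.

Lemma isotypic_spaceP v :
  reflect (exists X, v = coef_vec X) (v \in isotypic_space G chi).
Proof.
apply: (iffP memv_imgP) => [[u _ ->] | [X ->]].
  by rewrite lfunE; apply: projector_image.
by exists (coef_vec X); rewrite ?memvf // lfunE /= projector_coef_vec.
Qed.

Lemma inner_coef_vec X Y :
  inner (coef_vec X) (coef_vec Y) = #|G|%:R / d%:R * \tr (Y *m X^t*).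
Proof.
rewrite -(schur_trace_mul irr_r) [RHS]big_enum_val; apply: eq_bigr => i _.
rewrite !mxE mxtraceC_conj trmxC_mul unitary_r ?groupV ?enum_valP // invgK.
by rewrite mxtrace_mulC.
Qed.

(** The inner product of the vector of X with its translate by g is
   (|G| / d) tr(H r(g)). As H is Hermitian, the conjugate of this trace is
   tr(H r(g)^-1), and Schur orthogonality sums the squared moduli. *)
Lemma energy_coef_vec X (H := X *m X^t*) :
  orbit_energy (coef_vec X)
    = d%:R^-1 * ((#|G|%:R / d%:R) ^+ 2 * \tr (H *m H)).
Proof.
have H_adj : H^t* = H by rewrite trmxC_mul trmxCK.
pose q : C := #|G|%:R / d%:R.
transitivity (#|G|%:R^-1 * (q ^+ 2 *
   \sum_(g in G) \tr (H *m r g) * \tr (H *m r g^-1%g))).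
  congr (_ * _); rewrite mulr_sumr; apply: eq_bigr => g Gg.
  rewrite left_regular_coef_vec // inner_coef_vec -mulmxA mxtrace_mulC -/H.
  rewrite normrM exprMn !normCK mxtraceC_conj trmxC_mul H_adj unitary_r //.
  rewrite [\tr (r _ *m H)]mxtrace_mulC; congr (_ * _).
  by rewrite expr2 rmorphM /= fmorphV /= !conjC_nat.
rewrite schur_trace_mul // -/q /q.
by field; apply/andP.
Qed.

End CoefficientVectors.

(** * Energy maximizers and their translates *)

Section Algorithm.

Variables (C : numClosedFieldType) (gT : finGroupType) (G : {group gT}).
Variables (d : nat) (r : mx_representation C G d) (chi : gT -> C).
Hypothesis irr_r : mx_irreducible r.
Hypothesis unitary_r : {in G, forall g, (r g)^t* = r g^-1%g}.
Hypothesis chi_r : affords r chi.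

Let order_neq0 : #|G|%:R != 0 :> C.
Proof. by rewrite pnatr_eq0 -lt0n cardG_gt0. Qed.
Let degree_neq0 : d%:R != 0 :> C := irr_degree_neq0 irr_r.
Let degree_gt0 : (0 < d)%N := irr_degree_gt0 irr_r.

Lemma unit_coef_vec X : vnorm (coef_vec r X) = 1 ->
  \tr (X *m X^t*) = d%:R / #|G|%:R.
Proof.
move/vnorm1_inner; rewrite (inner_coef_vec irr_r unitary_r) => trX.
apply: (mulfI (_ : #|G|%:R / d%:R != 0)); first by rewrite mulf_neq0 ?invr_eq0.
by rewrite trX mulrA divfK // divff.
Qed.

Lemma energy_le v : unit_sphere (isotypic_space G chi) v ->
  orbit_energy v <= d%:R^-1.
Proof.
case=> /(isotypic_spaceP irr_r unitary_r chi_r)[X ->] /unit_coef_vec trX.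
rewrite (energy_coef_vec irr_r unitary_r) ler_piMr ?invr_ge0 ?ler0n //.
apply: le_trans (_ : (#|G|%:R / d%:R) ^+ 2 * (\tr (X *m X^t*)) ^+ 2 <= 1).
  by rewrite ler_wpM2l ?gram_trace_sq_le // exprn_ge0 // divr_ge0 ?ler0n.
by rewrite trX -exprMn mulrA divfK // divff // expr1n.
Qed.

(** Since tr H = d / |G| on the unit sphere, the value 1 / d amounts to
   tr(H^2) = (tr H)^2. *)
Lemma energy_eq X : vnorm (coef_vec r X) = 1 ->
  orbit_energy (coef_vec r X) = d%:R^-1 <->
  exists (a : 'cV_d) (b : 'rV_d), X = a *m b.
Proof.
move/unit_coef_vec=> trX; rewrite -gram_trace_sq_eq trX.
rewrite (energy_coef_vec irr_r unitary_r) -[in d%:R / _]invf_div.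
set q := #|G|%:R / d%:R; set t := \tr _.
have nz_q : q ^+ 2 != 0 by rewrite expf_neq0 // mulf_neq0 ?invr_eq0.
have nz_dV : d%:R^-1 != 0 :> C by rewrite invr_eq0.
have q_qV : q ^+ 2 * q^-1 ^+ 2 = 1 by rewrite exprVn mulfV.
split=> [eqF | ->]; last by rewrite q_qV mulr1.
by apply: (mulfI nz_q); apply: (mulfI nz_dV); rewrite eqF q_qV mulr1.
Qed.

(** Any nonzero matrix of rank one gives a maximizer once normalized. *)
Lemma energy_max_exists : exists v,
  unit_sphere (isotypic_space G chi) v /\ orbit_energy v = d%:R^-1.
Proof.
pose i0 := Ordinal degree_gt0.
pose X : 'M[C]_d := (delta_mx i0 0 : 'cV_d) *m (delta_mx 0 i0 : 'rV_d).
have nzX : coef_vec r X != 0.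
  rewrite raddf_eq0; last exact: coef_vec_inj.
  rewrite /X mul_delta_mx; apply/eqP=> /matrixP/(_ i0 i0).
  by rewrite !mxE !eqxx => /eqP; rewrite oner_eq0.
exists (coef_vec r ((vnorm (coef_vec r X))^-1 *: X)).
have unit_v : vnorm (coef_vec r ((vnorm (coef_vec r X))^-1 *: X)) = 1.
  by rewrite linearZ vnorm_normalize.
split.
  by split=> //; apply/(isotypic_spaceP irr_r unitary_r chi_r); eexists.
apply/energy_eq => //; exists ((vnorm (coef_vec r X))^-1 *: delta_mx i0 0).
by exists (delta_mx 0 i0); rewrite -scalemxAl.
Qed.

(** The intertwiner y |-> coef_vec r (y b) from C^d to C[G], as a matrix. *)
Definition copy_mx (b : 'rV[C]_d) : 'M[C]_(#|G|, d) :=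
  \matrix_(i, k) (b *m r (enum_val i)^-1%g) 0 k.

Lemma copy_mx_mul b (y : 'cV_d) : copy_mx b *m y = coef_vec r (y *m b).
Proof.
apply/colP=> i; rewrite [RHS]mxE -mulmxA mxtrace_mulC /mxtrace big_ord1.
by rewrite !mxE; apply: eq_bigr => k _; rewrite mxE.
Qed.

(** A nonzero entry of b forces y = 0 when y b = 0. The transpose expresses the
   independence of columns through [row_free]. *)
Lemma copy_mx_free b : b != 0 -> row_free (copy_mx b)^T.
Proof.
case/rV0Pn=> k nz_bk; apply/row_free_trP=> y.
rewrite copy_mx_mul -(raddf0 (coef_vec r)) => /(coef_vec_inj irr_r) yb0.
apply/colP=> i; apply: (mulIf nz_bk); rewrite mxE mul0r.
by move/matrixP/(_ i k): yb0; rewrite !mxE big_ord1.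
Qed.

Lemma copy_mx_hom b g : g \in G ->
  left_regular_repr C G g *m copy_mx b = copy_mx b *m r g.
Proof.
move=> Gg; apply/matrixP=> i k; have Gi := enum_valP i.
rewrite left_regular_mulE // mxE gring_indexK ?groupM ?groupV //.
rewrite invMg invgK repr_mxM ?groupV // mulmxA !mxE.
by apply: eq_bigr => l _; rewrite [in RHS]mxE.
Qed.

Lemma free_translatesE n (h : 'I_n -> gT) (v : 'cV[C]_#|G|) :
  free (translates h v) = row_free (translates_mx h v)^T.
Proof.
have mulE (y : 'cV[C]_n) : translates_mx h v *m y
    = \sum_j y j 0 *: (translates h v)`_j.
  apply/colP=> i; rewrite mxE summxE; apply: eq_bigr => j _.
  by rewrite !mxE (tnth_nth 0) mulrC.
apply/freeP/row_free_trP => [freeX y | inj k k0 j].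
  by rewrite mulE => /freeX y0; apply/colP=> j; rewrite y0 mxE.
have /inj/colP/(_ j) : translates_mx h v *m (\col_j k j) = 0.
  by rewrite mulE -[RHS]k0; apply: eq_bigr => l _; rewrite mxE.
by rewrite !mxE.
Qed.

Definition coords_mx (h : 'I_d -> gT) (a : 'cV[C]_d) : 'M[C]_d :=
  \matrix_(i, j) (r (h j) *m a) i 0.

Lemma translates_coords h a b : (forall i, h i \in G) ->
  translates_mx h (coef_vec r (a *m b)) = copy_mx b *m coords_mx h a.
Proof.
move=> Gh; apply/matrixP=> i j; rewrite mxE tnth_mktuple.
rewrite left_regular_coef_vec // mulmxA -copy_mx_mul [LHS]mxE [RHS]mxE.
by apply: eq_bigr => k _; rewrite [coords_mx _ _ _ _]mxE.
Qed.

Lemma free_translates_coords h a b : (forall i, h i \in G) -> b != 0 ->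
  free (translates h (coef_vec r (a *m b))) = (coords_mx h a \in unitmx).
Proof.
move=> Gh nz_b; rewrite free_translatesE translates_coords //.
rewrite trmx_mul /row_free mxrankMfree ?copy_mx_free //.
by rewrite -unitmx_tr -row_free_unit.
Qed.

Lemma coords_unit_exists a : a != 0 ->
  exists h : 'I_d -> gT, (forall i, h i \in G) /\ coords_mx h a \in unitmx.
Proof.
move=> nz_a; have full : row_full (orbit_mx r a)^T.
  by rewrite /row_full mxrank_tr; apply: orbit_mx_free.
(* Row i of the transposed orbit matrix is the translate by enum_val i, so a
   maximal independent set of rows selects the group elements. *)
exists (fun i => enum_val (fullrankfun full i)); split=> [i|].
  exact: enum_valP.
rewrite -unitmx_tr; have := fullrowsub_unit full; congr (_ \in unitmx).
by apply/matrixP=> i j; rewrite !mxE.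
Qed.

End Algorithm.

Theorem theorem3 (R : realType) (gT : finGroupType) (G : {group gT})
    (S : {set gT}) (chi : gT -> R[i]) (d : nat)
    (S_gen : <<S>>%g = G)
    (chi_irr : irreducible_character G chi)
    (chi_deg : chi 1%g = d%:R) :
  (exists b : seq 'cV[R[i]]_#|G|, basis_of (isotypic_space G chi) b) /\
  (exists u : 'cV[R[i]]_#|G|, isotypic_projector G chi *m u != 0) /\
  (forall u : 'cV[R[i]]_#|G|, isotypic_projector G chi *m u != 0 ->
     unit_sphere (isotypic_space G chi)
       ((vnorm (isotypic_projector G chi *m u))^-1 *:
          (isotypic_projector G chi *m u))) /\
  (exists v : 'cV[R[i]]_#|G|, energy_maximizer chi v) /\
  (forall v : 'cV[R[i]]_#|G|, energy_maximizer chi v ->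
     orbit_energy v = d%:R^-1 /\
     (exists h : 'I_d -> gT, (forall i, h i \in G) /\ free (translates h v)) /\
     (forall h : 'I_d -> gT, (forall i, h i \in G) -> free (translates h v) ->
        (exists A : gT -> 'M[R[i]]_d, forall s, s \in S ->
           left_regular_repr _ G s *m translates_mx h v
             = translates_mx h v *m A s) /\
        (forall A : gT -> 'M[R[i]]_d,
           (forall s, s \in S ->
              left_regular_repr _ G s *m translates_mx h v
                = translates_mx h v *m A s) ->
           exists rG : mx_representation R[i] G d,
             [/\ mx_irreducible rG, affords rG chi &
                 forall s, s \in S -> rG s = A s]))).
Proof.
have SG s : s \in S -> s \in G by rewrite -S_gen; apply: mem_gen.
case: chi_irr => n [rG [irr_rG rG_chi]].
have def_n : n = d.
  by apply/eqP; rewrite -(eqr_nat R[i]) -chi_deg -rG_chi // repr_mx1 mxtrace1.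
rewrite {n}def_n in rG irr_rG rG_chi.
have [r [irr_r unitary_r tr_r]] := irr_unitarizable irr_rG.
have r_chi : affords r chi by move=> g Gg; rewrite tr_r // rG_chi.
have [v0 [unit_v0 energy_v0]] := energy_max_exists irr_r unitary_r r_chi.
have unitP := energy_le irr_r unitary_r r_chi.
have spaceP := isotypic_spaceP irr_r unitary_r r_chi.
split; first by exists (vbasis (isotypic_space G chi)); apply: vbasisP.
split.
  case: unit_v0 => /spaceP[X def_v0] norm_v0; exists v0.
  rewrite def_v0 (projector_coef_vec irr_r unitary_r r_chi) -def_v0.
  by rewrite -inner_eq0 vnorm1_inner // oner_eq0.
split.
  move=> u nz_u; split; last exact: vnorm_normalize.
  have [X defX] := projector_image unitary_r r_chi u.
  by apply: memvZ; apply/spaceP; exists X.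
split.
  by exists v0; split=> // w unit_w; rewrite energy_v0; apply: unitP.
move=> v [unit_v max_v].
have energy_v : orbit_energy v = d%:R^-1.
  by apply: le_anti; rewrite unitP // -energy_v0 max_v.
split=> //; case: unit_v => /spaceP[X def_v] norm_v.
have nz_v : v != 0 by rewrite -inner_eq0 vnorm1_inner // oner_eq0.
rewrite {}def_v in energy_v norm_v nz_v *.
case/(energy_eq irr_r unitary_r norm_v): energy_v => a [b defX].
rewrite {}defX in norm_v nz_v *.
have nz_a : a != 0.
  by apply: contraNneq nz_v => ->; rewrite mul0mx raddf0.
have nz_b : b != 0.
  by apply: contraNneq nz_v => ->; rewrite mulmx0 raddf0.
split.
  have [h [Gh uT]] := coords_unit_exists irr_r nz_a.
  by exists h; rewrite free_translates_coords.
move=> h Gh; rewrite free_translates_coords // => uT.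
rewrite translates_coords //; set T := coords_mx r h a in uT *.
have uT' : invmx T \in unitmx by rewrite unitmx_inv.
pose rT := rconj_repr r uT'.
(* The intertwiner cancels on the left of lambda(s) B = B M, leaving
   r(s) T = T M. *)
have rT_solves s : s \in S -> forall M,
    left_regular_repr _ G s *m (copy_mx r b *m T) = copy_mx r b *m T *m M
    <-> M = rT s.
  move=> Ss M; rewrite mulmxA copy_mx_hom ?SG // -!mulmxA.
  rewrite [rT s]rconj_mxE invmxK -mulmxA.
  split=> [eqM | ->]; last by rewrite mulKVmx.
  rewrite -[LHS](mulKmx uT); congr (_ *m _); apply: trmx_inj.
  apply: (row_free_inj (copy_mx_free irr_r nz_b)).
  by rewrite -!trmx_mul eqM.
split; first by exists rT => s Ss; apply/rT_solves.
move=> A solA; exists rT; split.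
- exact/conj_mx_irr.
- by move=> g Gg; rewrite rconj_mxE mxtrace_mulC invmxK mulKVmx // r_chi.
- by move=> s Ss; apply/esym/rT_solves/solA.
Qed.
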